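(* Consider the multinomial logistic model $\mathbf C^T\log(\mathbf L\boldsymbol\pi_i)=\mathbf X_i\boldsymbol\theta$, $i=1,\dots,m$ (see context), with independent observations. Then the Fisher information matrix of $\boldsymbol\theta$ is $\mathbf F=n\,\mathbf G^T\mathbf W\mathbf G$, where $\mathbf W={\rm diag}\{w_1{\rm diag}(\boldsymbol\pi_1)^{-1},\dots,w_m{\rm diag}(\boldsymbol\pi_m)^{-1}\}$ is the $mJ\times mJ$ diagonal matrix with $w_i=n_i/n$, and $\mathbf G$ is the $mJ\times p$ matrix whose $i$th block of $J$ rows ($i=1,\dots,m$) is $$\Big(\mathbf c_{i1}\mathbf h_1^T(\mathbf x_i),\ \dots,\ \mathbf c_{i,J-1}\mathbf h_{J-1}^T(\mathbf x_i),\ \textstyle\sum_{j=1}^{J-1}\mathbf c_{ij}\cdot\mathbf h_c^T(\mathbf x_i)\Big).$$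
   Context: Let $d\ge 1$, $m\ge 2$, $J\ge 2$ be integers, $\mathbf x_1,\dots,\mathbf x_m\in\mathbb R^d$ distinct experimental settings, and $n_1,\dots,n_m\ge 0$ integers with $n=\sum_i n_i>0$. For each $i$ with $n_i>0$ one observes $\mathbf Y_i=(Y_{i1},\dots,Y_{iJ})^T\sim{\rm Multinomial}(n_i;\pi_{i1},\dots,\pi_{iJ})$, independently over $i$; write $\boldsymbol\pi_i=(\pi_{i1},\dots,\pi_{iJ})^T$, $\sum_j\pi_{ij}=1$. Model. Known functions $\mathbf h_j$ with values in $\mathbb R^{p_j}$ ($j=1,\dots,J-1$) and $\mathbf h_c$ with values in $\mathbb R^{p_c}$ are given; the parameter is $\boldsymbol\theta=(\boldsymbol\beta_1^T,\dots,\boldsymbol\beta_{J-1}^T,\boldsymbol\zeta^T)^T\in\mathbb R^p$ with $\boldsymbol\beta_j\in\mathbb R^{p_j}$, $\boldsymbol\zeta\in\mathbb R^{p_c}$, $p=p_1+\dots+p_{J-1}+p_c$. ($p_c=0$, i.e. no $\mathbf h_c,\boldsymbol\zeta$, is allowed.) For one fixed choice among four logit types, $\log(\nu_{ij}/\delta_{ij})=\mathbf h_j^T(\mathbf x_i)\boldsymbol\beta_j+\mathbf h_c^T(\mathbf x_i)\boldsymbol\zeta$ for $j=1,\dots,J-1$, where $(\nu_{ij},\delta_{ij})$ is: $(\pi_{ij},\pi_{iJ})$ (baseline-category); $(\pi_{i1}+\dots+\pi_{ij},\ \pi_{i,j+1}+\dots+\pi_{iJ})$ (cumulative); $(\pi_{ij},\pi_{i,j+1})$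 (adjacent-categories); $(\pi_{ij},\ \pi_{i,j+1}+\dots+\pi_{iJ})$ (continuation-ratio). It is assumed that $\pi_{ij}>0$ for all $i,j$. Matrix form: $\mathbf C^T\log(\mathbf L\boldsymbol\pi_i)=\mathbf X_i\boldsymbol\theta$ with entrywise $\log$, where $\mathbf C^T=\begin{pmatrix}\mathbf I_{J-1}&-\mathbf I_{J-1}&\mathbf 0\\ \mathbf 0^T&\mathbf 0^T&1\end{pmatrix}$ is $J\times(2J-1)$; $\mathbf L$ is the $(2J-1)\times J$ 0-1 matrix with $(\mathbf L\boldsymbol\pi_i)_j=\nu_{ij}$, $(\mathbf L\boldsymbol\pi_i)_{J-1+j}=\delta_{ij}$ ($j=1,\dots,J-1$), and last row all ones; and $\mathbf X_i$ is the $J\times p$ matrix whose $j$th row ($j\le J-1$) has $\mathbf h_j^T(\mathbf x_i)$ in the block of columns of $\boldsymbol\beta_j$, $\mathbf h_c^T(\mathbf x_i)$ in the block of columns of $\boldsymbol\zeta$, and zeros elsewhere, and whose last row is zero. With $\mathbf D_i={\rm diag}(\mathbf L\boldsymbol\pi_i)$, the $J\times J$ matrix $\mathbf C^T\mathbf D_i^{-1}\mathbf L$ is nonsingular; write $(\mathbf C^T\mathbf D_i^{-1}\mathbf L)^{-1}=(\mathbf c_{i1},\dots,\mathbf c_{iJ})$ by columns. The Fisher information matrix is the covariance matrix of the score vector $\partial l/\partial\boldsymbol\theta$, where $l$ is the log-likelihood of $(\mathbf Y_i)_i$. *)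

(* Defs.v *)
From HB Require Import structures.
From mathcomp Require Import all_boot all_order all_algebra.
From mathcomp Require Import all_classical all_reals all_analysis.

Set Implicit Arguments.
Unset Strict Implicit.
Unset Printing Implicit Defensive.

Import Order.TTheory GRing.Theory Num.Theory.
Import numFieldNormedType.Exports.

Local Open Scope classical_set_scope.
Local Open Scope ring_scope.

(* The number of response categories is J = q + 1. Category j <= J - 1 is
   [lshift 1 j] with [j : 'I_q]; category J is [rshift q ord0]. *)

Inductive logit_type := Baseline | Cumulative | Adjacent | Continuation.

(* 0-1 matrices sending pi_i to (nu_ij)_(j < J) and (delta_ij)_(j < J); row and
   column indices count from 0, so that column q is category J. *)
Definition numer_mx (R : realType) (q : nat) (t : logit_type) : 'M[R]_(q, q + 1) :=
  \matrix_(j < q, l < q + 1)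
    match t with
    | Cumulative => (l <= j)%N%:R
    | Baseline | Adjacent | Continuation => (l == j :> nat)%:R
    end.

Definition denom_mx (R : realType) (q : nat) (t : logit_type) : 'M[R]_(q, q + 1) :=
  \matrix_(j < q, l < q + 1)
    match t with
    | Baseline => (l == q :> nat)%:R
    | Adjacent => (l == j.+1 :> nat)%:R
    | Cumulative | Continuation => (j < l)%N%:R
    end.

Definition L_mx (R : realType) (q : nat) (t : logit_type) :
    'M[R]_(q + q + 1, q + 1) :=
  col_mx (col_mx (numer_mx R q t) (denom_mx R q t)) (const_mx 1).

Definition CT_mx (R : realType) (q : nat) : 'M[R]_(q + 1, q + q + 1) :=
  block_mx (row_mx 1%:M (- 1%:M)) 0 0 1%:M.

Definition D_mx (R : realType) (q : nat) (t : logit_type) (pi : 'cV[R]_(q + 1)) :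
    'M[R]_(q + q + 1) :=
  diag_mx (L_mx R q t *m pi)^T.

Definition CDL_mx (R : realType) (q : nat) (t : logit_type)
    (pi : 'cV[R]_(q + 1)) : 'M[R]_(q + 1) :=
  CT_mx R q *m invmx (D_mx t pi) *m L_mx R q t.

Definition c_vec (R : realType) (q : nat) (t : logit_type) (pi : 'cV[R]_(q + 1))
    (j : 'I_q) : 'cV[R]_(q + 1) :=
  col (lshift 1 j) (invmx (CDL_mx t pi)).

Definition X_mx (R : realType) (d q : nat) (p_ : 'I_q -> nat) (pc : nat)
    (h : forall j : 'I_q, 'cV[R]_d -> 'cV[R]_(p_ j)) (hc : 'cV[R]_d -> 'cV[R]_pc)
    (x : 'cV[R]_d) : 'M[R]_(q + 1, (\sum_(j < q) p_ j) + pc) :=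
  col_mx
    (row_mx (\mxrow_(j < q) (delta_mx j (ord0 : 'I_1) *m (h j x)^T))
            ((const_mx 1 : 'cV[R]_q) *m (hc x)^T))
    (0 : 'M[R]_(1, _)).

Definition logit_model (R : realType) (m q p : nat) (t : logit_type)
    (X : 'I_m -> 'M[R]_(q + 1, p)) (theta : 'cV[R]_p)
    (pi : 'I_m -> 'cV[R]_(q + 1)) : Prop :=
  forall i : 'I_m,
    [/\ forall j, 0 < pi i j ord0,
        \sum_j pi i j ord0 = 1
      & CT_mx R q *m map_mx (@ln R) (L_mx R q t *m pi i) = X i *m theta].

(* For the cumulative logit not every theta gives positive probabilities. *)
Definition param_space (R : realType) (m q p : nat) (t : logit_type)
    (X : 'I_m -> 'M[R]_(q + 1, p)) : set 'cV[R]_p :=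
  [set theta | exists pi, logit_model t X theta pi].

Definition multinomial_pmf (R : realType) (J : nat) (N : nat) (pi : 'cV[R]_J)
    (y : J.-tuple nat) : R :=
  if (\sum_(j < J) tnth y j)%N == N then
    N`!%:R / (\prod_(j < J) (tnth y j)`!)%N%:R
      * \prod_(j < J) pi j ord0 ^+ tnth y j
  else 0.

Definition is_multinomial (R : realType) (dT : measure_display)
    (T : measurableType dT) (P : probability T R) (J : nat)
    (Y : {RV P >-> J.-tuple nat}) (N : nat) (pi : 'cV[R]_J) : Prop :=
  forall y : J.-tuple nat,
    distribution P Y [set y] = (multinomial_pmf N pi y)%:E.

Definition mutually_independent (R : realType) (dT dU : measure_display)
    (T : measurableType dT) (U : measurableType dU) (P : probability T R)
    (I : finType) (K : {set I}) (Y : I -> {RV P >-> U}) : Prop :=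
  forall (S : {set I}) (A : I -> set U),
    S \subset K -> (forall i, measurable (A i)) ->
    P (\bigcap_(i in [set i | i \in S]) (Y i @^-1` A i)) =
    (\prod_(i in S) P (Y i @^-1` A i))%E.

Definition loglik (R : realType) (m J p : nat) (n_ : 'I_m -> nat)
    (pi : 'cV[R]_p -> 'I_m -> 'cV[R]_J) (y : 'I_m -> J.-tuple nat)
    (theta : 'cV[R]_p) : R :=
  ln (\prod_(i < m | (0 < n_ i)%N) multinomial_pmf (n_ i) (pi theta i) (y i)).

Definition score (R : realType) (m J p : nat) (n_ : 'I_m -> nat)
    (pi : 'cV[R]_p -> 'I_m -> 'cV[R]_J) (y : 'I_m -> J.-tuple nat)
    (theta : 'cV[R]_p) : 'cV[R]_p :=
  \col_(k < p) 'D_(delta_mx k ord0) (loglik n_ pi y) theta.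

Definition covariance_mx (R : realType) (dT : measure_display)
    (T : measurableType dT) (P : probability T R) (p : nat) (S : T -> 'cV[R]_p) :
    'M[\bar R]_p :=
  \matrix_(k < p, l < p)
    covariance P (fun w => S w k ord0) (fun w => S w l ord0).

(* [P] is the law of the experiment under the parameter value [theta]. *)
Definition fisher_information (R : realType) (dT : measure_display)
    (T : measurableType dT) (P : probability T R) (m J p : nat)
    (n_ : 'I_m -> nat) (pi : 'cV[R]_p -> 'I_m -> 'cV[R]_J)
    (Y : 'I_m -> {RV P >-> J.-tuple nat}) (theta : 'cV[R]_p) : 'M[\bar R]_p :=
  covariance_mx P (fun w => score n_ pi (fun i => Y i w) theta).

Definition W_mx (R : realType) (m J : nat) (n_ : 'I_m -> nat)
    (pi : 'I_m -> 'cV[R]_J) : 'M[R]_(\sum_(i < m) J) :=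
  \mxdiag_(i < m)
    (((n_ i)%:R / (\sum_(i0 < m) n_ i0)%N%:R) *: invmx (diag_mx (pi i)^T)).

Definition G_block (R : realType) (d q : nat) (p_ : 'I_q -> nat) (pc : nat)
    (h : forall j : 'I_q, 'cV[R]_d -> 'cV[R]_(p_ j)) (hc : 'cV[R]_d -> 'cV[R]_pc)
    (t : logit_type) (x : 'cV[R]_d) (pi : 'cV[R]_(q + 1)) :
    'M[R]_(q + 1, (\sum_(j < q) p_ j) + pc) :=
  row_mx (\mxrow_(j < q) (c_vec t pi j *m (h j x)^T))
         ((\sum_(j < q) c_vec t pi j) *m (hc x)^T).

Definition G_mx (R : realType) (d m q : nat) (p_ : 'I_q -> nat) (pc : nat)
    (h : forall j : 'I_q, 'cV[R]_d -> 'cV[R]_(p_ j)) (hc : 'cV[R]_d -> 'cV[R]_pc)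
    (t : logit_type) (x : 'I_m -> 'cV[R]_d) (pi : 'I_m -> 'cV[R]_(q + 1)) :
    'M[R]_(\sum_(i < m) (q + 1), (\sum_(j < q) p_ j) + pc) :=
  \mxcol_(i < m) G_block h hc t (x i) (pi i).

(* Main.v *)
(* Write nu_j = e^(eta_j) delta_j for the logit equations: together with
   sum_l pi_l = 1 they form a linear system odds_mx(e^eta) pi = e_J, which is
   invertible for every eta.  So pi is unique, and along a line in theta it is
   the smooth curve odds_mx(e^eta)^-1 e_J, which stays positive near the base
   point; differentiating the system gives
   d pi_i = (C^T D_i^-1 L)^-1 X_i d theta, that is, the i-th block G_i of G.
   Almost surely the score is therefore sum_i G_i^T diag(pi_i)^-1 Y_i.  As the
   columns of G_i sum to 0, each term is centred and its covariance reduces to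
   n_i G_i^T diag(pi_i)^-1 G_i; independence kills the cross terms. *)
Require Import Defs.
From HB Require Import structures.
From mathcomp Require Import all_boot all_order all_algebra.
From mathcomp Require Import all_classical all_reals all_analysis.
From mathcomp Require Import measurable_realfun ring.

Set Implicit Arguments.
Unset Strict Implicit.
Unset Printing Implicit Defensive.

Import Order.TTheory GRing.Theory Num.Theory.
Import numFieldNormedType.Exports.

Local Open Scope classical_set_scope.
Local Open Scope ring_scope.

(** * The logit equations as a linear system *)

Lemma leq_ord_addn1 q (l : 'I_(q + 1)) : (l <= q)%N.
Proof. by rewrite -ltnS; case: l => l /=; rewrite addn1. Qed.

Section Logit.
Variables (R : realType) (q : nat).
Implicit Types (t : logit_type) (e : 'I_q -> R) (u : 'cV[R]_(q + 1)).

Lemma numer_mx_ge0 t j l : 0 <= numer_mx R q t j l.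
Proof. by rewrite mxE; case: t. Qed.

Lemma denom_mx_ge0 t j l : 0 <= denom_mx R q t j l.
Proof. by rewrite mxE; case: t. Qed.

Lemma numer_mx_neq0 t j : exists l, 0 < numer_mx R q t j l.
Proof.
by exists (lshift 1 j); rewrite mxE; case: t; rewrite /= ?leqnn ?eqxx ltr01.
Qed.

Lemma denom_mx_neq0 t j : exists l, 0 < denom_mx R q t j l.
Proof.
case: t; try by exists (rshift q ord0);
  rewrite mxE /= addn0 ?ltn_ord ?eqxx ltr01.
(* Category J is the witness for the other three types; the adjacent denominator is the single
   category after j. *)
have hj : (j.+1 < q + 1)%N by rewrite addn1 ltnS.
by exists (Ordinal hj); rewrite mxE /= eqxx ltr01.
Qed.

Lemma mulmx_gt0 (A : 'M[R]_(q, q + 1)) (u : 'cV[R]_(q + 1)) j :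
  (forall l, 0 <= A j l) -> (exists l, 0 < A j l) -> (forall l, 0 < u l ord0) ->
  0 < (A *m u) j ord0.
Proof.
move=> A0 [l Al] u0; rewrite mxE (bigD1 l) //=.
by rewrite ltr_pwDl ?mulr_gt0// sumr_ge0// => k _; rewrite mulr_ge0// ltW.
Qed.

Lemma numer_gt0 t u j : (forall l, 0 < u l ord0) ->
  0 < (numer_mx R q t *m u) j ord0.
Proof.
by apply: mulmx_gt0; [move=> l; exact: numer_mx_ge0 | exact: numer_mx_neq0].
Qed.

Lemma denom_gt0 t u j : (forall l, 0 < u l ord0) ->
  0 < (denom_mx R q t *m u) j ord0.
Proof.
by apply: mulmx_gt0; [move=> l; exact: denom_mx_ge0 | exact: denom_mx_neq0].
Qed.

(** As the entries sum to 0, the tail after j is minus the partial sum S_j up to j, so the jth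
    equation reads (1 + e_j) S_j = 0. Vanishing partial sums kill the entries one after another, and
    the zero total kills the last one. *)
Lemma eq_odds_cumulative e u : (forall j, 0 < e j) ->
  (forall j, (numer_mx R q Defs.Cumulative *m u) j ord0 =
             e j * (denom_mx R q Defs.Cumulative *m u) j ord0) ->
  \sum_l u l ord0 = 0 -> u = 0.
Proof.
move=> e0 Nu su.
have S0 (j : 'I_q) : \sum_(l : 'I_(q + 1) | (l <= j)%N) u l ord0 = 0.
  have := Nu j; rewrite !mxE.
  under eq_bigr do rewrite mxE mulr_natl mulrb.
  rewrite -big_mkcond /=.
  under [X in _ = _ * X -> _]eq_bigr do rewrite mxE mulr_natl mulrb.
  rewrite -big_mkcond /= => h.
  have h2 : \sum_(l : 'I_(q + 1) | (j < l)%N) u l ord0 =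
            - \sum_(l : 'I_(q + 1) | (l <= j)%N) u l ord0.
    move: su; rewrite (bigID (fun l : 'I_(q + 1) => (l <= j)%N)) /=.
    under [X in _ + X]eq_bigl do rewrite -ltnNge.
    by move/eqP; rewrite addrC addr_eq0 => /eqP.
  move: h; rewrite h2 mulrN => /eqP; rewrite -addr_eq0.
  rewrite -[X in X + _]mul1r -mulrDl mulf_eq0 gt_eqF ?addr_gt0//=.
  by move/eqP.
have u0 k : forall l : 'I_(q + 1), l = k :> nat -> u l ord0 = 0.
  elim/ltn_ind: k => k IH l lk.
  have [kq|qk] := ltnP k q.
    have := S0 (Ordinal kq); rewrite (bigD1 l) /=; last by rewrite lk.
    rewrite big1 ?addr0// => l' /andP[l'k l'l]; apply: (IH l') => //.
    by rewrite ltn_neqAle l'k andbT; apply: contraNneq l'l => l'k';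
      apply/eqP/val_inj; rewrite /= l'k' lk.
  move: su; rewrite (bigD1 l) //= big1 ?addr0// => l' l'l; apply: (IH l') => //.
  rewrite ltn_neqAle; apply/andP; split.
    by apply: contraNneq l'l => l'k'; apply/eqP/val_inj; rewrite /= l'k' lk.
  by apply: leq_trans qk; rewrite leq_ord_addn1.
by apply/matrixP => l c; rewrite ord1 mxE; exact: u0.
Qed.

(* Outside the cumulative case the equations express [u l] as a nonnegative
   combination of later entries, so that all entries share the sign of the
   last one. *)
Lemma eq_odds_local t e u : t <> Defs.Cumulative -> (forall j, 0 < e j) ->
  (forall j, (numer_mx R q t *m u) j ord0 =
             e j * (denom_mx R q t *m u) j ord0) ->
  \sum_l u l ord0 = 0 -> u = 0.
Proof.
move=> tC e0; wlog uq : u / 0 <= u (rshift q ord0) ord0.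
  move=> wl; have [uq|uq] := leP 0 (u (rshift q ord0) ord0); first exact: wl.
  move=> Nu su; apply: oppr_inj; rewrite oppr0; apply: wl.
  - by rewrite mxE oppr_ge0 ltW.
  - have oppE (v : 'cV[R]_q) i : (- v) i ord0 = - v i ord0 by rewrite mxE.
    by move=> j; rewrite !mulmxN !oppE Nu mulrN.
  - by under eq_bigr do rewrite mxE; rewrite sumrN su oppr0.
move=> Nu su.
have Nl (j : 'I_q) : (numer_mx R q t *m u) j ord0 = u (lshift 1 j) ord0.
  rewrite mxE (bigD1 (lshift 1 j)) //= big1 ?addr0 => [|l lj].
    by rewrite mxE; case: t tC {Nu} => //=; rewrite eqxx mul1r.
  have lj' : (l == j :> nat) = false.
    by apply/negbTE; apply: contraNneq lj => lj; apply/eqP/val_inj.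
  by rewrite mxE; case: t tC {Nu} => //=; rewrite lj' mul0r.
have Dl (j : 'I_q) (l : 'I_(q + 1)) : (l <= j)%N -> denom_mx R q t j l = 0.
  move=> lj; rewrite mxE; case: t tC {Nu Nl} => //= _.
  - by rewrite ltn_eqF// (leq_ltn_trans lj).
  - by rewrite ltn_eqF.
  - by rewrite ltnNge lj.
have u0 k : forall l : 'I_(q + 1), (q - l)%N = k -> 0 <= u l ord0.
  elim/ltn_ind: k => k IH l lk; have [lq|ql] := ltnP l q; last first.
    suff -> : l = rshift q ord0 by [].
    apply/val_inj/eqP; rewrite /= addn0 eqn_leq ql andbT.
    by rewrite leq_ord_addn1.
  rewrite (_ : l = lshift 1 (Ordinal lq)); last exact/val_inj.
  rewrite -Nl Nu; apply: mulr_ge0; first exact: ltW.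
  rewrite mxE; apply: sumr_ge0 => l' _.
  have [l'l|ll'] := leqP l' (Ordinal lq); first by rewrite Dl// mul0r.
  rewrite mulr_ge0 ?denom_mx_ge0//; apply: (IH (q - l')%N) => //.
  by rewrite -lk ltn_sub2l.
apply/matrixP => l c; rewrite ord1 mxE; apply/eqP.
have /eqP := su; rewrite psumr_eq0 => [/allP/(_ l)|l' _]; last exact: u0.
by rewrite mem_index_enum; apply.
Qed.

(** The kernel computation behind the invertibility of both [odds_mx] and [CDL_mx]. *)
Lemma eq_odds_eq0 t e u : (forall j, 0 < e j) ->
  (forall j, (numer_mx R q t *m u) j ord0 =
             e j * (denom_mx R q t *m u) j ord0) ->
  \sum_l u l ord0 = 0 -> u = 0.
Proof.
by case: t; first [exact: eq_odds_cumulative | apply: eq_odds_local].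
Qed.

Lemma unitmx_ker (F : fieldType) k (A : 'M[F]_k) :
  (forall u : 'cV[F]_k, A *m u = 0 -> u = 0) -> A \in unitmx.
Proof.
move=> kerA; rewrite -unitmx_tr -row_free_unit; apply: inj_row_free => v vA.
apply: trmx_inj; rewrite trmx0; apply: kerA.
by rewrite -[A]trmxK -trmx_mul vA trmx0.
Qed.

Lemma invmx_diag (F : fieldType) k (d : 'rV[F]_k) :
  (forall i, d ord0 i != 0) ->
  invmx (diag_mx d) = diag_mx (map_mx GRing.inv d).
Proof.
move=> d0; have dd : diag_mx (map_mx GRing.inv d) *m diag_mx d = 1%:M.
  apply/matrixP => i j; rewrite mul_diag_mx !mxE.
  by case: eqVneq => [->|]; rewrite ?mulr0 // mulr1n mulVf.
by have [_ ud] := mulmx1_unit dd; rewrite -[LHS]mul1mx -dd mulmxK.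
Qed.

Definition odds_mx t e : 'M[R]_(q + 1) :=
  col_mx (numer_mx R q t - diag_mx (\row_j e j) *m denom_mx R q t) (const_mx 1).

Lemma odds_mxu t e u j :
  (odds_mx t e *m u) (lshift 1 j) ord0 =
  (numer_mx R q t *m u) j ord0 - e j * (denom_mx R q t *m u) j ord0.
Proof. by rewrite mul_col_mx col_mxEu mulmxBl -mulmxA mul_diag_mx !mxE. Qed.

Lemma const_mx1_mul n (u : 'cV[R]_n) i :
  ((const_mx 1 : 'M[R]_(1, n)) *m u) i ord0 = \sum_l u l ord0.
Proof. by rewrite mxE; apply: eq_bigr => l _; rewrite mxE mul1r. Qed.

Lemma odds_mxd t e u i :
  (odds_mx t e *m u) (rshift q i) ord0 = \sum_l u l ord0.
Proof. by rewrite mul_col_mx col_mxEd const_mx1_mul. Qed.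

Lemma odds_mx_unit t e : (forall j, 0 < e j) -> odds_mx t e \in unitmx.
Proof.
move=> e0; apply: unitmx_ker => u Mu; apply: (@eq_odds_eq0 t e) => // [j|].
  by apply/eqP; rewrite -subr_eq0 -odds_mxu Mu mxE.
by rewrite -(odds_mxd t e u ord0) Mu mxE.
Qed.

Lemma odds_mxP t e u : (forall j, (numer_mx R q t *m u) j ord0 =
    e j * (denom_mx R q t *m u) j ord0) /\ \sum_l u l ord0 = 1 <->
  odds_mx t e *m u = delta_mx (rshift q ord0) ord0.
Proof.
split=> [[Nu su]|Mu].
  apply/matrixP => i c; rewrite ord1 [RHS]mxE andbT -[i]splitK.
  case: splitP => k _ /=.
    by rewrite odds_mxu Nu subrr eq_lrshift.
  by rewrite odds_mxd su ord1 eqxx.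
split=> [j|].
  by apply/eqP; rewrite -subr_eq0 -odds_mxu Mu mxE eq_lrshift.
by rewrite -(odds_mxd t e u ord0) Mu mxE eqxx.
Qed.

Lemma L_mx_gt0 t u : (forall l, 0 < u l ord0) ->
  forall i, 0 < (L_mx R q t *m u) i ord0.
Proof.
move=> u0 i; rewrite !mul_col_mx -[i]splitK; case: splitP => k _ /=.
  rewrite col_mxEu -[k]splitK; case: splitP => j _ /=.
    by rewrite col_mxEu numer_gt0.
  by rewrite col_mxEd denom_gt0.
rewrite col_mxEd const_mx1_mul (bigD1 (rshift q ord0)) //=.
by rewrite ltr_pwDl// sumr_ge0// => l _; rewrite ltW.
Qed.

Lemma CT_mxu (z : 'cV[R]_(q + q + 1)) j :
  (CT_mx R q *m z) (lshift 1 j) ord0 =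
  z (lshift 1 (lshift q j)) ord0 - z (lshift 1 (rshift q j)) ord0.
Proof.
rewrite -[z in LHS]vsubmxK mul_block_col col_mxEu mul0mx addr0.
rewrite -[usubmx z]vsubmxK mul_row_col mul1mx mulNmx mul1mx.
by rewrite !mxE.
Qed.

Lemma CT_mxd (z : 'cV[R]_(q + q + 1)) :
  (CT_mx R q *m z) (rshift q ord0) ord0 = z (rshift (q + q) ord0) ord0.
Proof.
by rewrite -[z in LHS]vsubmxK mul_block_col col_mxEd mul0mx add0r mul1mx mxE.
Qed.

Lemma invD_mul t (pi u : 'cV[R]_(q + 1)) i : (forall l, 0 < pi l ord0) ->
  (invmx (D_mx t pi) *m (L_mx R q t *m u)) i ord0 =
  (L_mx R q t *m u) i ord0 / (L_mx R q t *m pi) i ord0.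
Proof.
move=> pi0; rewrite invmx_diag => [|k]; last first.
  by rewrite mxE gt_eqF// L_mx_gt0.
by rewrite mul_diag_mx !mxE mulrC.
Qed.

Lemma CDL_mxu t (pi u : 'cV[R]_(q + 1)) j : (forall l, 0 < pi l ord0) ->
  (CDL_mx t pi *m u) (lshift 1 j) ord0 =
  (numer_mx R q t *m u) j ord0 / (numer_mx R q t *m pi) j ord0 -
  (denom_mx R q t *m u) j ord0 / (denom_mx R q t *m pi) j ord0.
Proof.
move=> pi0; rewrite -!mulmxA CT_mxu !invD_mul//.
by rewrite !mul_col_mx !col_mxEu !col_mxEd.
Qed.

Lemma CDL_mxd t (pi u : 'cV[R]_(q + 1)) : (forall l, 0 < pi l ord0) ->
  (CDL_mx t pi *m u) (rshift q ord0) ord0 =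
  (\sum_l u l ord0) / (\sum_l pi l ord0).
Proof.
move=> pi0; rewrite -!mulmxA CT_mxd !invD_mul//.
by rewrite !mul_col_mx !col_mxEd !const_mx1_mul.
Qed.

(** A kernel vector u has nu_j(u) / nu_j(pi) = delta_j(u) / delta_j(pi), which is the homogeneous
    odds system for e_j = nu_j(pi) / delta_j(pi); the last row makes its total vanish. *)
Lemma CDL_mx_unit t (pi : 'cV[R]_(q + 1)) : (forall l, 0 < pi l ord0) ->
  CDL_mx t pi \in unitmx.
Proof.
move=> pi0; apply: unitmx_ker => u Cu.
have N0 j := numer_gt0 t j pi0; have D0 j := denom_gt0 t j pi0.
apply: (@eq_odds_eq0 t
  (fun j => (numer_mx R q t *m pi) j ord0 / (denom_mx R q t *m pi) j ord0)).
- by move=> j; rewrite divr_gt0.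
- move=> j.
  have := CDL_mxu t u j pi0; rewrite Cu [LHS]mxE => /esym/eqP.
  rewrite subr_eq0 => /eqP NuDu.
  by rewrite -mulrA [X in _ * X]mulrC -NuDu mulrC mulfVK ?gt_eqF.
- have := CDL_mxd t u pi0; rewrite Cu [LHS]mxE => /esym/eqP.
  rewrite mulf_eq0 invr_eq0.
  case/orP => /eqP// spi0; move: (L_mx_gt0 t pi0 (rshift (q + q) ord0)).
  by rewrite mul_col_mx col_mxEd const_mx1_mul spi0 ltxx.
Qed.

Lemma logit_eqP t (pi : 'cV[R]_(q + 1)) (eta : 'cV[R]_q) :
  (forall l, 0 < pi l ord0) -> \sum_l pi l ord0 = 1 ->
  CT_mx R q *m map_mx (@ln R) (L_mx R q t *m pi) = col_mx eta 0 <->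
  odds_mx t (fun j => expR (eta j ord0)) *m pi = delta_mx (rshift q ord0) ord0.
Proof.
move=> pi0 spi; have N0 j := numer_gt0 t j pi0; have D0 j := denom_gt0 t j pi0.
have lnE n (z : 'cV[R]_n) i : map_mx (@ln R) z i ord0 = ln (z i ord0).
  by rewrite mxE.
have Cu j : (CT_mx R q *m map_mx (@ln R) (L_mx R q t *m pi)) (lshift 1 j) ord0 =
    ln ((numer_mx R q t *m pi) j ord0) - ln ((denom_mx R q t *m pi) j ord0).
  by rewrite CT_mxu !lnE !mul_col_mx !col_mxEu col_mxEd.
rewrite -odds_mxP; split=> [Ceta|[Npi _]].
  split=> // j; have := Cu j; rewrite Ceta col_mxEu => ->.
  by rewrite expRD expRN !lnK ?posrE// mulfVK ?gt_eqF.
apply/matrixP => i c; rewrite ord1 -[i]splitK; case: splitP => k _ /=.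
  rewrite Cu col_mxEu Npi lnM ?posrE ?expR_gt0// expRK.
  by rewrite -addrA subrr addr0.
(* The last coordinate is the logarithm of the total mass, ln 1 = 0. *)
by rewrite [k]ord1 CT_mxd lnE mul_col_mx !col_mxEd const_mx1_mul spi ln1 mxE.
Qed.

End Logit.

(** Each h_j^T enters [X_mx] behind a unit column, which the inverse sends to c_j; the all-ones
    column in front of h_c^T goes to the sum of the c_j. The last column of the inverse meets the
    zero row of [X_mx]. *)
Lemma G_blockE (R : realType) (d q : nat) (p_ : 'I_q -> nat) (pc : nat)
    (h : forall j : 'I_q, 'cV[R]_d -> 'cV[R]_(p_ j)) (hc : 'cV[R]_d -> 'cV[R]_pc)
    (t : logit_type) (x : 'cV[R]_d) (pi : 'cV[R]_(q + 1)) :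
  G_block h hc t x pi = invmx (CDL_mx t pi) *m X_mx h hc x.
Proof.
rewrite -[invmx _]hsubmxK mul_row_col mulmx0 addr0 mul_mx_row mul_mxrow.
have cE j : lsubmx (invmx (CDL_mx t pi)) *m delta_mx j ord0 = c_vec t pi j.
  by rewrite -colE; apply/matrixP => i k; rewrite !mxE.
congr row_mx; first by apply: eq_mxrow => j; rewrite mulmxA cE.
rewrite mulmxA; congr (_ *m _); under eq_bigr do rewrite -cE.
rewrite -mulmx_sumr; congr (_ *m _); apply/matrixP => i k.
rewrite mxE summxE (bigD1 i) //= mxE ord1 !eqxx big1 ?addr0// => j ji.
by rewrite mxE eq_sym (negbTE ji).
Qed.

(** The factor n cancels the denominator of w_i = n_i / n, which leaves the form in which the
    covariances will come out. *)
Lemma gram_GWG (R : realType) (d m q : nat) (p_ : 'I_q -> nat) (pc : nat)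
    (h : forall j : 'I_q, 'cV[R]_d -> 'cV[R]_(p_ j)) (hc : 'cV[R]_d -> 'cV[R]_pc)
    (t : logit_type) (x : 'I_m -> 'cV[R]_d) (n_ : 'I_m -> nat)
    (pi : 'I_m -> 'cV[R]_(q + 1)) k l :
  (0 < \sum_(i < m) n_ i)%N -> (forall i j, 0 < pi i j ord0) ->
  ((\sum_(i < m) n_ i)%N%:R *:
     ((G_mx h hc t x pi)^T *m W_mx n_ pi *m G_mx h hc t x pi)) k l =
  \sum_(i < m) (n_ i)%:R * \sum_j G_block h hc t (x i) (pi i) j k *
     G_block h hc t (x i) (pi i) j l / pi i j ord0.
Proof.
move=> n0 pi0; rewrite -mulmxA mul_mxdiag_mxcol tr_mxcol mul_mxrow_mxcol.
rewrite mxE summxE mulr_sumr; apply: eq_bigr => i _.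
rewrite invmx_diag => [|j]; last by rewrite mxE gt_eqF.
rewrite -scalemxAl -scalemxAr mxE mulrA mulrCA divff ?mulr1; last first.
  by rewrite pnatr_eq0 -lt0n.
rewrite mxE; congr (_ * _); apply: eq_bigr => j _.
by rewrite mul_diag_mx !mxE -mulrA [_^-1 * _]mulrC.
Qed.

(** * Derivatives of the probabilities and of the log-likelihood *)

Section MatrixLimits.
Variables (R : realType) (T : Type) (F : set_system T).
Context {FF : Filter F}.

Lemma cvg_mulmx k n p (A : T -> 'M[R]_(k, n)) (B : T -> 'M[R]_(n, p))
    (A0 : 'M[R]_(k, n)) (B0 : 'M[R]_(n, p)) :
  (forall i j, A s i j @[s --> F] --> A0 i j) ->
  (forall i j, B s i j @[s --> F] --> B0 i j) ->
  forall i j, (A s *m B s) i j @[s --> F] --> (A0 *m B0) i j.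
Proof.
move=> cA cB i j; rewrite mxE; under eq_fun do rewrite mxE.
apply: (cvg_big (@add_continuous R)) => l _.
by apply: cvgM; [exact: cA | exact: cB].
Qed.

Lemma cvg_det n (A : T -> 'M[R]_n) (A0 : 'M[R]_n) :
  (forall i j, A s i j @[s --> F] --> A0 i j) ->
  \det (A s) @[s --> F] --> \det A0.
Proof.
move=> cA; apply: (cvg_big (@add_continuous R)) => sigma _.
apply: cvgM; first exact: cvg_cst.
by apply: (cvg_big (@mul_continuous R)) => i _; exact: cA.
Qed.

(** Cramer's formula: the unit hypotheses select the adjugate branch of [invmx], and cofactors are
    again determinants of convergent matrices. *)
Lemma cvg_invmx n (A : T -> 'M[R]_n) (A0 : 'M[R]_n) : A0 \in unitmx ->
  (forall s, A s \in unitmx) ->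
  (forall i j, A s i j @[s --> F] --> A0 i j) ->
  forall i j, invmx (A s) i j @[s --> F] --> invmx A0 i j.
Proof.
move=> uA0 uA cA i j; rewrite /invmx uA0.
under eq_fun do rewrite uA !mxE.
rewrite !mxE; apply: cvgM; last first.
  apply: cvgM; first exact: cvg_cst.
  apply: cvg_det => a b; rewrite !mxE.
  by under eq_fun do rewrite !mxE; exact: cA.
apply: cvgV; last exact: cvg_det.
by move: uA0; rewrite unitmxE unitfE.
Qed.

End MatrixLimits.

Lemma is_derive0P (R : realType) (f : R -> R) (df : R) :
  is_derive (0 : R) 1 f df <-> s^-1 * (f s - f 0) @[s --> 0^'] --> df.
Proof.
have fE : (fun s : R => s^-1 *: ((f \o shift 0) (s *: 1) - f 0)) =
          (fun s => s^-1 * (f s - f 0)).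
  by apply/funext => s /=; rewrite addr0 [_%:A]mulr1.
split=> [[fd <-]|cf].
  by rewrite -fE.
apply: DeriveDef; first by apply/cvg_ex; exists df; rewrite fE.
by rewrite /derive fE; exact: cvg_lim.
Qed.

(** * The solution of the logit equations along a line eta + s xi *)

Section LogitCurve.
Variables (R : realType) (q : nat) (t : logit_type) (eta xi : 'cV[R]_q).

Let e s j := expR (eta j ord0 + s * xi j ord0).

(** Defined for every s, whether or not its entries are positive, so it can be differentiated at 0
    without knowing which nearby parameters are admissible. *)
Definition logit_curve (s : R) : 'cV[R]_(q + 1) :=
  invmx (odds_mx t (e s)) *m delta_mx (rshift q ord0) ord0.

Lemma logit_curveP s (pi : 'cV[R]_(q + 1)) :
  (forall l, 0 < pi l ord0) -> \sum_l pi l ord0 = 1 ->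
  CT_mx R q *m map_mx (@ln R) (L_mx R q t *m pi) = col_mx (eta + s *: xi) 0 <->
  pi = logit_curve s.
Proof.
move=> pi0 spi; have uM : odds_mx t (e s) \in unitmx.
  by apply: odds_mx_unit => j; exact: expR_gt0.
rewrite logit_eqP//.
have -> : (fun j => expR ((eta + s *: xi) j ord0)) = e s.
  by apply/funext => j; rewrite !mxE.
by rewrite /logit_curve; split=> [<-|->]; [rewrite mulKmx | rewrite mulKVmx].
Qed.

Lemma odds_mx_curve s :
  odds_mx t (e s) *m logit_curve s = delta_mx (rshift q ord0) ord0.
Proof. by apply: mulKVmx; apply: odds_mx_unit => j; exact: expR_gt0. Qed.

Lemma logit_curve_sum s : \sum_l logit_curve s l ord0 = 1.
Proof.
by case: ((odds_mxP t (e s) (logit_curve s)).2 (odds_mx_curve s)).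
Qed.

Let e_is_derive j : is_derive (0 : R) 1 (e ^~ j) (e 0 j * xi j ord0).
Proof.
rewrite /e mul0r addr0.
apply: (@is_derive1_comp _ expR (fun s => eta j ord0 + s * xi j ord0)).
  by rewrite mul0r addr0; exact: is_derive_expR.
rewrite (_ : (fun s => _) = cst (eta j ord0) + xi j ord0 *: id); last first.
  by apply/funext => s /=; rewrite mulrC.
have D := is_deriveD (is_derive_cst (eta j ord0 : R) (0 : R) (1 : R))
  (is_deriveZ (xi j ord0) (is_derive_id (0 : R) (1 : R))).
by apply: (is_derive_eq D); rewrite add0r; exact: mulr1.
Qed.

Lemma cvg_odds_mx i k :
  odds_mx t (e s) i k @[s --> 0^'] --> odds_mx t (e 0) i k.
Proof.
have ce j : e s j @[s --> 0^'] --> e 0 j.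
  have /derivable1_diffP/differentiable_continuous :=
    @ex_derive _ _ _ _ _ _ _ (e_is_derive j).
  by move=> c; apply: cvg_trans c; apply: cvg_app; exact: cvg_within.
rewrite -[i]splitK; case: splitP => j _ /=; last first.
  by rewrite col_mxEd; under eq_fun do rewrite col_mxEd; exact: cvg_cst.
rewrite col_mxEu; under eq_fun do rewrite col_mxEu mul_diag_mx !mxE.
rewrite mul_diag_mx !mxE.
by apply: cvgB; [exact: cvg_cst | apply: cvgM; [exact: ce | exact: cvg_cst]].
Qed.

(** With M(s) the odds matrix and c the curve, M(s)(c(s) - c(0)) = e_J - M(s) c(0) has entries
    (e_j(s) - e_j(0)) delta_j and last entry 0. The difference quotient is therefore M(s)^-1 applied
    to scalar difference quotients, and only the continuity of the inverse is needed. *)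
Lemma is_derive_logit_curve l : (forall l, 0 < logit_curve 0 l ord0) ->
  is_derive (0 : R) 1 (fun s => logit_curve s l ord0)
    ((invmx (CDL_mx t (logit_curve 0)) *m col_mx xi 0) l ord0).
Proof.
move=> p0; have uM s : odds_mx t (e s) \in unitmx.
  by apply: odds_mx_unit => j; exact: expR_gt0.
pose delta j := (denom_mx R q t *m logit_curve 0) j ord0.
have Np j : (numer_mx R q t *m logit_curve 0) j ord0 = e 0 j * delta j.
  by case: ((odds_mxP t (e 0) (logit_curve 0)).2 (odds_mx_curve 0)).
pose w s : 'cV[R]_q := \col_j (s^-1 * (e s j - e 0 j) * delta j).
pose w0 : 'cV[R]_q := \col_j (e 0 j * xi j ord0 * delta j).
have curveB s : s^-1 *: (logit_curve s - logit_curve 0) =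
    invmx (odds_mx t (e s)) *m col_mx (w s) 0.
  rewrite -[LHS](mulKmx (uM s)); congr (_ *m _).
  rewrite -(scalemxAr s^-1 (odds_mx t (e s))).
  have -> : odds_mx t (e s) *m (logit_curve s - logit_curve 0) =
      delta_mx (rshift q ord0) ord0 - odds_mx t (e s) *m logit_curve 0.
    by rewrite mulmxBr; congr (_ - _); exact: odds_mx_curve.
  apply/matrixP => i c; rewrite [c]ord1 [LHS]mxE.
  rewrite [X in _ * X]mxE [X in _ * (_ + X)]mxE.
  rewrite -[i]splitK; case: splitP => k _ /=.
    rewrite odds_mxu Np col_mxEu -/(delta k) [w s _ _]mxE.
    by rewrite [delta_mx _ _ _ _]mxE eq_lrshift /=; ring.
  rewrite odds_mxd logit_curve_sum col_mxEd !mxE [k]ord1 !eqxx subrr.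
  exact: mulr0.
(* Identification of the limit u = M(0)^-1 (w0, 0): dividing its kth equation by nu_k = e_k delta_k
   gives nu_k(u) / nu_k - delta_k(u) / delta_k = xi_k, a row of the [CDL_mx] system. *)
have -> : invmx (CDL_mx t (logit_curve 0)) *m col_mx xi 0 =
    invmx (odds_mx t (e 0)) *m col_mx w0 0.
  apply: (canLR (mulKmx (CDL_mx_unit t p0))); apply: esym.
  set u := invmx (odds_mx t (e 0)) *m _.
  have Mu : odds_mx t (e 0) *m u = col_mx w0 0 by rewrite mulKVmx.
  apply/matrixP => i c; rewrite [c]ord1 -[i]splitK; case: splitP => k _ /=.
    have d0 := denom_gt0 t k p0; rewrite -/(delta k) in d0.
    have e0 : 0 < e 0 k by exact: expR_gt0.
    rewrite CDL_mxu// -/(delta k) Np col_mxEu.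
    have := odds_mxu t (e 0) u k; rewrite Mu col_mxEu mxE => Nu.
    have -> : (numer_mx R q t *m u) k ord0 =
      e 0 k * xi k ord0 * delta k + e 0 k * (denom_mx R q t *m u) k ord0.
      by rewrite Nu subrK.
    by field; rewrite !gt_eqF.
  rewrite [k]ord1 CDL_mxd// -(odds_mxd t (e 0) u ord0) Mu !col_mxEd !mxE.
  by rewrite mul0r.
apply/is_derive0P.
rewrite (_ : (fun s => _) = fun s =>
    (invmx (odds_mx t (e s)) *m col_mx (w s) 0) l ord0); last first.
  by apply/funext => s; rewrite -curveB !mxE.
apply: cvg_mulmx => [|i k].
  by apply: cvg_invmx => //; exact: cvg_odds_mx.
rewrite [k]ord1 -[i]splitK; case: splitP => j _ /=.
  rewrite col_mxEu mxE; under eq_fun do rewrite col_mxEu mxE.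
  by apply: cvgM; [exact/is_derive0P | exact: cvg_cst].
rewrite col_mxEd mxE; under eq_fun do rewrite col_mxEd mxE.
exact: cvg_cst.
Qed.

End LogitCurve.

Lemma ln_prod (R : realType) (I : Type) (r : seq I) (Q : pred I) (F : I -> R) :
  (forall i, Q i -> 0 < F i) ->
  ln (\prod_(i <- r | Q i) F i) = \sum_(i <- r | Q i) ln (F i).
Proof.
(* Positivity of the partial product is carried through the induction because [lnM] requires it. *)
move=> F0; suff [] : 0 < \prod_(i <- r | Q i) F i /\
    ln (\prod_(i <- r | Q i) F i) = \sum_(i <- r | Q i) ln (F i) by [].
elim/big_rec2: _ => [|i x y Qi [x0 <-]]; first by rewrite ln1.
by have Fi := F0 _ Qi; rewrite mulr_gt0 // lnM ?posrE.
Qed.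

Lemma is_derive_big (R : realType) (I : Type) (r : seq I) (Q : pred I)
    (f : I -> R -> R) (df : I -> R) (a : R) :
  (forall i, Q i -> is_derive a 1 (f i) (df i)) ->
  is_derive a 1 (fun s => \sum_(i <- r | Q i) f i s) (\sum_(i <- r | Q i) df i).
Proof.
move=> fdf; elim: r => [|i r IH].
  rewrite big_nil (_ : (fun s => _) = cst 0); first exact: is_derive_cst.
  by apply/funext => s; rewrite big_nil.
rewrite big_cons; case: ifPn => Qi.
  rewrite (_ : (fun s => _) = f i + (fun s => \sum_(i <- r | Q i) f i s)).
    by apply: is_deriveD; exact: fdf.
  by apply/funext => s; rewrite big_cons Qi.
by under eq_fun do rewrite big_cons (negbTE Qi).
Qed.

Lemma derive_line (R : realType) (V : normedModType R) (f : V -> R) (x v : V) :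
  'D_v f x = 'D_1 (fun s : R => f (s *: v + x)) 0.
Proof.
rewrite /derive; set g1 := fun h => h^-1 *: _; set g2 := fun h => h^-1 *: _.
suff -> : g1 = g2 by [].
by apply/funext => s; rewrite /g1 /g2 /= addr0 scale0r add0r [_%:A]mulr1.
Qed.

(** * The score as a linear function of the counts *)

Section Score.
Variables (R : realType) (m q p : nat) (t : logit_type) (n_ : 'I_m -> nat).
Variables (A : 'I_m -> 'M[R]_(q, p)).
Let X i : 'M[R]_(q + 1, p) := col_mx (A i) 0.
Variable pi : 'cV[R]_p -> 'I_m -> 'cV[R]_(q + 1).
Hypothesis hpi : forall theta,
  param_space t X theta -> logit_model t X theta (pi theta).
Variable theta : 'cV[R]_p.
Hypothesis htheta : param_space t X theta.

Lemma logit_curve_line v i s (u : 'cV[R]_(q + 1)) :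
  (forall l, 0 < u l ord0) -> \sum_l u l ord0 = 1 ->
  CT_mx R q *m map_mx (@ln R) (L_mx R q t *m u) = X i *m (s *: v + theta) <->
  u = logit_curve t (A i *m theta) (A i *m v) s.
Proof.
move=> u0 su; rewrite -logit_curveP// /X (mul_col_mx (A i)) mul0mx.
by rewrite mulmxDr addrC -scalemxAr.
Qed.

Lemma logit_curve0 v i : pi theta i = logit_curve t (A i *m theta) (A i *m v) 0.
Proof.
have [p0 sp mp] := hpi htheta i.
by apply: (@logit_curve_line v i 0 _ p0 sp).1; rewrite scale0r add0r.
Qed.

Lemma is_derive_curve v i l :
  is_derive (0 : R) 1
    (fun s => logit_curve t (A i *m theta) (A i *m v) s l ord0)
    ((invmx (CDL_mx t (pi theta i)) *m X i *m v) l ord0).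
Proof.
have [p0 sp mp] := hpi htheta i.
rewrite -mulmxA /X (mul_col_mx (A i)) mul0mx (logit_curve0 v i).
by apply: is_derive_logit_curve; rewrite -logit_curve0.
Qed.

(** Nothing but the model equations is known about [pi], so its regularity comes from the curve: the
    curve is continuous and positive at 0, finitely many entries stay positive together near 0, and
    uniqueness of the solution forces [pi] to equal it there. *)
Lemma near_pi_curve v : \forall s \near (0 : R), forall i,
  (forall l, 0 < pi (s *: v + theta) i l ord0) /\
  pi (s *: v + theta) i = logit_curve t (A i *m theta) (A i *m v) s.
Proof.
pose c i s := logit_curve t (A i *m theta) (A i *m v) s.
have cpos : \forall s \near (0 : R), forall i l, 0 < c i s l ord0.
  apply: (@filter_forall _ _ (fun i s => forall l, 0 < c i s l ord0) _
    (nbhs_filter (0 : R))) => i.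
  apply: (@filter_forall _ _ (fun l s => 0 < c i s l ord0) _
    (nbhs_filter (0 : R))) => l.
  have [p0 _ _] := hpi htheta i.
  have /derivable1_diffP/differentiable_continuous cc :=
    @ex_derive _ _ _ _ _ _ _ (is_derive_curve v i l).
  by apply: (cvgr_gt _ cc); rewrite -logit_curve0.
near=> s.
have pos i l : 0 < c i s l ord0 by move: i l; near: s.
(* The curve itself witnesses that the displaced parameter is admissible. *)
have ms : param_space t X (s *: v + theta).
  rewrite /param_space /=; exists (fun i => c i s).
  move=> i; split; [exact: pos | exact: logit_curve_sum |].
  exact: (@logit_curve_line v i s _ (pos i) (logit_curve_sum _ _ _ _)).2.
move=> i; have [p0 sp mp] := hpi ms i; split=> //.
exact: (@logit_curve_line v i s _ p0 sp).1.
Unshelve. all: by end_near. Qed.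

(** The partial derivative of ln pi_ij with respect to theta_k, which is the weight of the count
    Y_ij in the score. *)
Definition score_coef k i j : R :=
  (invmx (CDL_mx t (pi theta i)) *m X i) j k / pi theta i j ord0.

(** The last row of [CDL_mx] computes the total and the last row of X_i is zero, so the columns of
    the product of the inverse with X_i sum to 0. This is what centres the score. *)
Lemma sum_score_coef k i : \sum_j pi theta i j ord0 * score_coef k i j = 0.
Proof.
have [p0 sp _] := hpi htheta i.
pose u := invmx (CDL_mx t (pi theta i)) *m (X i *m delta_mx k (ord0 : 'I_1)).
have := CDL_mxd t u p0; rewrite mulKVmx ?CDL_mx_unit// sp divr1.
rewrite /X mul_col_mx mul0mx col_mxEd [LHS]mxE => su.
transitivity (\sum_l u l ord0); last exact: esym su.
apply: eq_bigr => j _; rewrite /score_coef mulrCA divff ?mulr1 ?gt_eqF//.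
by rewrite /u mulmxA -colE [RHS]mxE.
Qed.

(* Since [ln 0 = 0], the log-likelihood vanishes identically in [theta] when
   some count vector has the wrong total. *)
Lemma scoreE y k :
  score n_ pi y theta k ord0 =
  if [forall (i | (0 < n_ i)%N), (\sum_j tnth (y i) j)%N == n_ i] then
    \sum_(i < m | (0 < n_ i)%N) \sum_j score_coef k i j * (tnth (y i) j)%:R
  else 0.
Proof.
rewrite mxE; case: ifPn => [/forall_inP sy|]; last first.
  rewrite negb_forall_in => /exists_inP[i ni yi].
  rewrite (_ : loglik n_ pi y = cst 0); first exact: derive_cst.
  apply/funext => th; rewrite /loglik (bigD1 i) //= /multinomial_pmf.
  by rewrite (negbTE yi) mul0r ln0.
rewrite derive_line; set v := delta_mx k ord0.
pose c i s := logit_curve t (A i *m theta) (A i *m v) s.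
(* The multinomial coefficient: free of theta, so its logarithm drops out of the derivative. *)
pose C i : R := (n_ i)`!%:R / (\prod_(j < q + 1) (tnth (y i) j)`!)%N%:R.
have C0 i : 0 < C i.
  rewrite mulr_gt0 ?invr_gt0 ?ltr0n ?fact_gt0//.
  by apply: prodn_gt0 => j; exact: fact_gt0.
(* The curves replace [pi] only near s = 0, which is enough for a derivative at 0. *)
have loglikE : \forall s \near (0 : R),
    \sum_(i < m | (0 < n_ i)%N) (ln (C i) +
      \sum_j ln (c i s j ord0) *+ tnth (y i) j) =
    loglik n_ pi y (s *: v + theta).
  near=> s.
  have cs : forall i, (forall l, 0 < pi (s *: v + theta) i l ord0) /\
      pi (s *: v + theta) i = c i s by near: s; exact: near_pi_curve.
  rewrite /loglik ln_prod => [|i ni]; last first.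
    rewrite /multinomial_pmf sy// mulr_gt0// ?C0// prodr_gt0// => j _.
    by rewrite exprn_gt0//; case: (cs i).
  apply: eq_bigr => i ni; rewrite /multinomial_pmf sy//.
  have [pos csi] := cs i; rewrite csi in pos *.
  have P0 : 0 < \prod_j c i s j ord0 ^+ tnth (y i) j.
    by apply: prodr_gt0 => j _; rewrite exprn_gt0.
  rewrite -/(C i) (lnM (C0 i) P0).
  rewrite ln_prod => [|j _]; last by rewrite exprn_gt0.
  by congr (_ + _); apply: eq_bigr => j _; rewrite lnXn.
rewrite -(near_eq_derive _ loglikE).
apply: derive_val.
apply: is_derive_big => i ni; rewrite -[X in is_derive _ _ _ X]add0r.
apply: (is_deriveD (is_derive_cst (ln (C i) : R) (0 : R) (1 : R))).
apply: is_derive_big => j _.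
have [p0 _ _] := hpi htheta i; rewrite (logit_curve0 v) in p0.
have D := is_deriveZ (tnth (y i) j)%:R
  (is_derive1_comp (is_derive1_ln (p0 j)) (is_derive_curve v i j)).
rewrite (_ : (fun s => _) = (tnth (y i) j)%:R *:
    (@ln R \o fun s => c i s j ord0)); last first.
  by apply/funext => s; rewrite -[LHS]mulr_natl.
apply: (is_derive_eq D); rewrite -(logit_curve0 v) /score_coef.
rewrite [LHS]mulrC; congr (_ * _); rewrite mulrC; congr (_ / _).
by rewrite /v -colE [LHS]mxE.
Unshelve. all: by end_near. Qed.
End Score.

(** * Moments of the multinomial distribution *)

Section Multinomial.
Variables (R : realType) (J : nat) (pi : 'cV[R]_J).
Implicit Types (y : J.-tuple nat) (g : J.-tuple nat -> R) (a b : 'I_J -> R).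

Definition incr j y : J.-tuple nat := [tuple (tnth y i + (i == j))%N | i < J].

Lemma tnth_incr j y i : tnth (incr j y) i = (tnth y i + (i == j))%N.
Proof. by rewrite tnth_mktuple. Qed.

Lemma sum_incr j y : (\sum_i tnth (incr j y) i = (\sum_i tnth y i).+1)%N.
Proof.
under eq_bigr do rewrite tnth_incr.
have -> : \sum_i (tnth y i + (i == j))%N = (\sum_i tnth y i + 1)%N.
  rewrite big_split /=; congr (_ + _)%N; rewrite (bigD1 j) //= eqxx big1// => i.
  by move/negbTE ->.
by rewrite addn1.
Qed.

(* Expectation of [g] under the law of the counts of [N] independent draws,
   obtained by conditioning on the outcome [j] of one draw at a time. *)
Fixpoint mexp N g : R :=
  if N is N'.+1 then \sum_j pi j ord0 * mexp N' (g \o incr j)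
  else g [tuple 0%N | _ < J].

(** The recursion evaluates its argument only at count vectors reached after N draws. *)
Lemma eq_mexp N g1 g2 :
  (forall y, (\sum_i tnth y i = N)%N -> g1 y = g2 y) -> mexp N g1 = mexp N g2.
Proof.
elim: N g1 g2 => [|N IH] g1 g2 eg /=.
  by apply: eg; rewrite big1// => i _; rewrite tnth_mktuple.
apply: eq_bigr => j _; congr (_ * _); apply: IH => y sy.
by apply: eg; rewrite sum_incr sy.
Qed.

Lemma mexp_sum N (I : Type) (r : seq I) (c : I -> R)
    (g : I -> J.-tuple nat -> R) :
  mexp N (fun y => \sum_(i <- r) c i * g i y) =
  \sum_(i <- r) c i * mexp N (g i).
Proof.
elim: N g => [|N IH] g //=.
under eq_bigr do rewrite IH mulr_sumr.
rewrite exchange_big /=; apply: eq_bigr => i _; rewrite mulr_sumr.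
by apply: eq_bigr => j _; rewrite mulrCA.
Qed.

Lemma mexp0 N : mexp N (fun=> 0) = 0.
Proof.
elim: N => //= N IH; apply: big1 => j _.
by rewrite [mexp _ _]IH mulr0.
Qed.

(** Condition on one draw: for w = N! / prod y_i! times prod pi_i^y_i, outcome j contributes y_j w,
    and the y_j add up to N + 1, which turns N! into (N + 1)!. *)
Lemma mexp_indic N y : mexp N (fun z => (z == y)%:R) = multinomial_pmf N pi y.
Proof.
elim: N y => [|N IH] y /=.
  rewrite /multinomial_pmf; case: eqP => [<-|ny]; case: ifPn => //.
  - rewrite big1 => [_|i _]; last by rewrite tnth_mktuple.
    rewrite !big1 ?divr1 ?mulr1// => i _; rewrite tnth_mktuple//.
  - by rewrite big1// => i _; rewrite tnth_mktuple.
  - rewrite sum_nat_eq0 => /forall_inP y0; case: ny; apply: eq_from_tnth => i.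
    by rewrite tnth_mktuple; apply/esym/eqP; exact: y0.
pose decr j : J.-tuple nat := [tuple (tnth y i - (i == j))%N | i < J].
have tnth_decr j i : tnth (decr j) i = (tnth y i - (i == j))%N.
  by rewrite tnth_mktuple.
(* A draw of j can lead to y only if y_j > 0; the guard also excludes the case where the subtraction
   in [decr] truncates. *)
have step j : mexp N ((fun z => (z == y)%:R) \o incr j) =
    if (0 < tnth y j)%N then multinomial_pmf N pi (decr j) else 0.
  case: ifPn => yj.
    rewrite -IH; apply: eq_mexp => z _ /=; congr (_%:R); congr nat_of_bool.
    apply/eqP/eqP => [zy|->]; apply: eq_from_tnth => i.
      by rewrite tnth_decr -zy tnth_incr addnK.
    rewrite tnth_incr tnth_decr subnK//; case: eqP => [->|] //.
  rewrite -(mexp0 N); apply: eq_mexp => z _ /=; case: eqP => // zy; move: yj.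
  by rewrite -zy tnth_incr eqxx addn1.
have incr_decr j : (0 < tnth y j)%N -> incr j (decr j) = y.
  move=> yj; apply: eq_from_tnth => i.
  by rewrite tnth_incr tnth_decr subnK//; case: eqP => [->|].
under eq_bigr do rewrite step.
rewrite /multinomial_pmf; case: ifPn => [/eqP sy|sy]; last first.
  apply: big1 => j _; case: ifPn => yj; last by rewrite mulr0.
  rewrite ifN ?mulr0//; apply: contra sy => /eqP sd.
  by rewrite -(incr_decr _ yj) sum_incr sd.
pose w : R := N`!%:R / (\prod_i (tnth y i)`!)%N%:R *
  \prod_i pi i ord0 ^+ tnth y i.
have fact_neq0 z : (\prod_i (tnth z i)`!)%N%:R != 0 :> R.
  by rewrite pnatr_eq0 -lt0n prodn_gt0// => i; exact: fact_gt0.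
transitivity (\sum_j (tnth y j)%:R * w); last first.
  rewrite -mulr_suml -natr_sum sy factS natrM /w; ring.
apply: eq_bigr => j _; case: ifPn => yj; last first.
  by move: yj; rewrite -eqn0Ngt => /eqP ->; rewrite mulr0 mul0r.
have -> : (\sum_i tnth (decr j) i == N)%N.
  by rewrite -eqSS -(sum_incr j) incr_decr// sy.
have prod_pi : \prod_i pi i ord0 ^+ tnth y i =
    pi j ord0 * \prod_i pi i ord0 ^+ tnth (decr j) i.
  rewrite (bigD1 j) //= [in RHS](bigD1 j) //= mulrA -exprS.
  rewrite tnth_decr eqxx subn1 prednK//; congr (_ * _).
  by apply: eq_bigr => i /negbTE ij; rewrite tnth_decr ij subn0.
have prod_fact : (\prod_i (tnth y i)`! =
    tnth y j * \prod_i (tnth (decr j) i)`!)%N.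
  rewrite (bigD1 j) //= [in RHS](bigD1 j) //= mulnA; congr (_ * _)%N.
    by rewrite tnth_decr eqxx subn1 -{1 2}(prednK yj) factS.
  by apply: eq_bigr => i /negbTE ij; rewrite tnth_decr ij subn0.
rewrite /w prod_pi prod_fact natrM.
have yj0 : (tnth y j)%:R != 0 :> R by rewrite pnatr_eq0 -lt0n.
by field; rewrite fact_neq0 yj0.
Qed.

(** On totals N, g is the combination of point indicators with its own values as coefficients;
    linearity and [mexp_indic] finish. *)
Lemma mexpE N g (s : seq (J.-tuple nat)) : uniq s ->
  (forall y, (\sum_i tnth y i = N)%N -> y \in s) ->
  mexp N g = \sum_(y <- s) g y * multinomial_pmf N pi y.
Proof.
move=> us sN; under eq_bigr do rewrite -mexp_indic.
rewrite -mexp_sum; apply: eq_mexp => y /sN ys.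
rewrite (bigD1_seq y) //= eqxx mulr1 big1 ?addr0// => z zy.
by rewrite eq_sym (negbTE zy) mulr0.
Qed.

Hypothesis pi1 : \sum_j pi j ord0 = 1.

Lemma mexp_cst N c : mexp N (fun=> c) = c.
Proof.
elim: N => //= N IH; under eq_bigr do rewrite [mexp _ _]IH.
by rewrite -mulr_suml pi1 mul1r.
Qed.

Let lin a y : R := \sum_j a j * (tnth y j)%:R.

Lemma lin_incr a j y : lin a (incr j y) = lin a y + a j.
Proof.
rewrite /lin; under eq_bigr do rewrite tnth_incr natrD mulrDr.
rewrite big_split /=; congr (_ + _).
rewrite (bigD1 j) //= eqxx mulr1 big1 ?addr0// => i /negbTE ->.
exact: mulr0.
Qed.

(** The offsets u and v make the induction go through: a draw of j shifts them by a_j and b_j.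
    Averaging over j, the terms linear in a or b vanish by centring, and each draw adds one copy of
    the sum of pi_j a_j b_j. *)
Lemma mexp_linM N a b u v :
  \sum_j pi j ord0 * a j = 0 -> \sum_j pi j ord0 * b j = 0 ->
  mexp N (fun y => (u + lin a y) * (v + lin b y)) =
  u * v + N%:R * \sum_j pi j ord0 * (a j * b j).
Proof.
move=> a0 b0; elim: N u v => [|N IH] u v /=.
  have lin0 c : lin c [tuple 0%N | _ < J] = 0.
    by apply: big1 => i _; rewrite tnth_mktuple mulr0.
  by rewrite !lin0 !addr0 mul0r addr0.
have step j : mexp N ((fun y => (u + lin a y) * (v + lin b y)) \o incr j) =
    (u + a j) * (v + b j) + N%:R * \sum_j pi j ord0 * (a j * b j).
  rewrite -IH; apply: eq_mexp => y _ /=; rewrite !lin_incr; ring.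
under eq_bigr do rewrite step.
set S := \sum_j _ * (_ * _).
have -> : \sum_j pi j ord0 * ((u + a j) * (v + b j) + N%:R * S) =
  (u * v + N%:R * S) * (\sum_j pi j ord0) + u * (\sum_j pi j ord0 * b j) +
  v * (\sum_j pi j ord0 * a j) + S.
  rewrite !mulr_sumr -!big_split; apply: eq_bigr => j _ /=; ring.
rewrite a0 b0 pi1; ring.
Qed.

Lemma mexp_lin N a : \sum_j pi j ord0 * a j = 0 -> mexp N (lin a) = 0.
Proof.
move=> a0; have z0 : \sum_j pi j ord0 * 0 = 0.
  by apply: big1 => j _; exact: mulr0.
(* Second factor constantly 1: offset 1 and zero coefficients. *)
have := mexp_linM N 0 1 a0 z0; rewrite mul0r add0r.
under [X in _ * X]eq_bigr do rewrite !mulr0.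
rewrite big1// mulr0 => <-; apply: eq_mexp => y _.
have -> : lin (fun=> 0) y = 0 by apply: big1 => j _; exact: mul0r.
by rewrite add0r addr0 mulr1.
Qed.

End Multinomial.

(** * Random variables with finitely many relevant values *)

(** The space of tuples is countable, and a singleton is a finite intersection of coordinate
    preimages. *)
Lemma measurable_tuple_nat J (A : set (J.-tuple nat)) : measurable A.
Proof.
apply: countable_measurable => [y|]; last exact: countableP.
rewrite (_ : [set y] =
    \bigcap_(i in [set: 'I_J]) ((@tnth J nat ^~ i) @^-1` [set tnth y i])).
  apply: fin_bigcap_measurable => [|i _]; first exact: finite_finset.
  by rewrite -[X in measurable X]setTI; exact: measurable_tnth.
apply/seteqP; split => [_ -> i _ //|z yz].
by apply: eq_from_tnth => i; exact: yz.
Qed.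

Section HasExpectation.
Variables (R : realType) (d : measure_display) (T : measurableType d).
Variable P : probability T R.
Implicit Types (X : T -> R) (e : R).

(** Integrability travels with the value because additivity of the integral asks for it. *)
Definition has_expectation X e :=
  P.-integrable setT (EFin \o X) /\ ('E_P[X] = e%:E)%E.

Lemma has_expectation_indic (A : set T) : measurable A ->
  has_expectation \1_A (fine (P A)).
Proof.
move=> mA; split; first exact: integrable_indic.
by rewrite expectation_indic// fineK// fin_num_measure.
Qed.

Lemma has_expectationZ c X e : has_expectation X e ->
  has_expectation (fun w => c * X w) (c * e).
Proof.
move=> [iX eX]; split; first exact: (integrableZl measurableT c iX).
move: eX; rewrite !expectation.unlock => eX.
by under eq_integral do rewrite EFinM; rewrite integralZl// eX.
Qed.

Lemma has_expectation0 : has_expectation (fun=> 0) 0.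
Proof.
split; first exact: finite_measure_integrable_cst.
by rewrite (expectation_cst P 0).
Qed.

Lemma has_expectation_sum (I : Type) (r : seq I) (Q : pred I)
    (X : I -> T -> R) (e : I -> R) :
  (forall i, Q i -> has_expectation (X i) (e i)) ->
  has_expectation (fun w => \sum_(i <- r | Q i) X i w)
    (\sum_(i <- r | Q i) e i).
Proof.
move=> Xe; elim: r => [|i r IH].
  by rewrite big_nil; under eq_fun do rewrite big_nil; exact: has_expectation0.
rewrite big_cons; under eq_fun do rewrite big_cons; case: ifP => // Qi.
have [iX eX] := Xe _ Qi; have [iS eS] := IH.
split; first exact: (integrableD measurableT iX iS).
move: eX eS; rewrite !expectation.unlock => eX eS.
by under eq_integral do rewrite EFinD; rewrite integralD// eX eS.
Qed.

Lemma eq_expectation_ae X1 X2 :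
  measurable_fun setT X1 -> measurable_fun setT X2 ->
  (\forall w \ae P, X1 w = X2 w) -> ('E_P[X1] = 'E_P[X2])%E.
Proof.
move=> m1 m2 e12; rewrite expectation.unlock; apply: ae_eq_integral => //.
- exact/measurable_EFinP.
- exact/measurable_EFinP.
- by apply: filterS e12 => w /= ->.
Qed.

Lemma has_expectation_measurable X e :
  has_expectation X e -> measurable_fun setT X.
Proof. by move=> [iX _]; apply/measurable_EFinP; exact: measurable_int iX. Qed.

End HasExpectation.

(** The weak compositions of N into J parts; no part exceeds N, so tuples over ['I_N.+1] reach all
    of them. *)
Definition compositions J N : seq (J.-tuple nat) :=
  [seq y <- undup [seq map_tuple val z | z : J.-tuple 'I_N.+1] |
     (\sum_i tnth y i == N)%N].

Lemma mem_compositions J N y :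
  (y \in compositions J N) = (\sum_i tnth y i == N)%N.
Proof.
rewrite mem_filter; case: eqP => //= sy; rewrite mem_undup.
apply/fintype.imageP; exists (map_tuple (inord : nat -> 'I_N.+1) y) => //.
apply: eq_from_tnth => i; rewrite !tnth_map inordK// ltnS -sy.
by rewrite (bigD1 i)//= leq_addr.
Qed.

Lemma compositions_uniq J N : uniq (compositions J N).
Proof. exact/filter_uniq/undup_uniq. Qed.

Section TruncatedStatistic.
Variables (R : realType) (d : measure_display) (T : measurableType d).
Variables (P : probability T R) (J : nat).
Implicit Types (Y : {RV P >-> J.-tuple nat}) (pi : 'cV[R]_J).

(** This is g(Y) cut off to the event that the counts total N, written as a finite combination of
    indicators so that moments become finite sums. *)
Definition trunc_stat Y N (g : J.-tuple nat -> R) (w : T) : R :=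
  \sum_(y <- compositions J N) g y * \1_(Y @^-1` [set y]) w.

Lemma trunc_statE Y N g w :
  trunc_stat Y N g w = if (\sum_i tnth (Y w) i == N)%N then g (Y w) else 0.
Proof.
rewrite /trunc_stat -mem_compositions; case: ifPn => Yw.
  rewrite (bigD1_seq (Y w)) ?compositions_uniq//= indicE mem_set// mulr1.
  rewrite big1 ?addr0// => y yY; rewrite indicE memNset ?mulr0//= => Yy.
  by rewrite Yy eqxx in yY.
rewrite big_seq big1// => y ys; rewrite indicE memNset ?mulr0//= => Yy.
by rewrite Yy ys in Yw.
Qed.

Lemma trunc_statM Y N g g' w :
  trunc_stat Y N g w * trunc_stat Y N g' w =
  trunc_stat Y N (fun y => g y * g' y) w.
Proof. by rewrite !trunc_statE; case: ifP => // _; rewrite mulr0. Qed.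

Lemma measurable_preimage_RV Y (A : set (J.-tuple nat)) :
  measurable (Y @^-1` A).
Proof.
by rewrite -[X in measurable X]setTI; apply: measurable_funP => //;
  exact: measurable_tuple_nat.
Qed.

Lemma mexp_compositions pi N g : mexp pi N g =
  \sum_(y <- compositions J N) g y * multinomial_pmf N pi y.
Proof.
apply: mexpE; first exact: compositions_uniq.
by move=> y /eqP; rewrite mem_compositions.
Qed.

Lemma has_expectation_trunc_stat Y N pi g : is_multinomial Y N pi ->
  has_expectation P (trunc_stat Y N g) (mexp pi N g).
Proof.
move=> hY; rewrite mexp_compositions; apply: has_expectation_sum => y _.
apply: has_expectationZ; have -> : multinomial_pmf N pi y =
    fine (P (Y @^-1` [set y])) by rewrite -[P _]/(distribution P Y [set y]) hY.
by apply: has_expectation_indic; exact: measurable_preimage_RV.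
Qed.

(** The truncation of the constant 1 is the indicator of the event, and its mean [mexp] of 1 equals
    1. *)
Lemma ae_sum_multinomial Y N pi : \sum_j pi j ord0 = 1 ->
  is_multinomial Y N pi -> \forall w \ae P, (\sum_i tnth (Y w) i = N)%N.
Proof.
move=> pi1 hY; pose B := Y @^-1` [set y | (\sum_i tnth y i = N)%N].
have mB : measurable B by exact: measurable_preimage_RV.
have PB : P B = 1%E.
  have [_] := has_expectation_trunc_stat (fun=> 1) hY.
  rewrite mexp_cst// => <-; rewrite -(expectation_indic P mB).
  congr expectation; apply/funext => w; rewrite trunc_statE indicE.
  case: eqP => sy; first by rewrite mem_set.
  by rewrite memNset.
have PCB : P (~` B) = 0%E by rewrite probability_setC// PB subee.
by apply/(@negligibleP _ _ _ P (~` B)) => //; exact: measurableC.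
Qed.

(** The product expands into indicators of joint point events, so independence is needed on
    singletons only. *)
Lemma has_expectation_trunc_statM Y Y' N N' pi pi' g g' :
  is_multinomial Y N pi -> is_multinomial Y' N' pi' ->
  (forall y y', P (Y @^-1` [set y] `&` Y' @^-1` [set y']) =
     (P (Y @^-1` [set y]) * P (Y' @^-1` [set y']))%E) ->
  has_expectation P (fun w => trunc_stat Y N g w * trunc_stat Y' N' g' w)
    (mexp pi N g * mexp pi' N' g').
Proof.
move=> hY hY' ind; rewrite !mexp_compositions mulr_suml.
rewrite (_ : (fun w => _) = fun w => \sum_(y <- compositions J N)
   \sum_(y' <- compositions J N')
     g y * g' y' * \1_(Y @^-1` [set y] `&` Y' @^-1` [set y']) w); last first.
  apply/funext => w; rewrite /trunc_stat mulr_suml; apply: eq_bigr => y _.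
  rewrite mulr_sumr; apply: eq_bigr => y' _.
  by rewrite indicI /= mulrACA.
apply: has_expectation_sum => y _; rewrite mulr_sumr.
apply: has_expectation_sum => y' _; rewrite mulrACA.
apply: has_expectationZ.
have -> : multinomial_pmf N pi y * multinomial_pmf N' pi' y' =
    fine (P (Y @^-1` [set y] `&` Y' @^-1` [set y'])).
  by rewrite ind -[P _]/(distribution P Y [set y])
    -[P (Y' @^-1` _)]/(distribution P Y' [set y']) hY hY'.
by apply: has_expectation_indic; apply: measurableI;
  exact: measurable_preimage_RV.
Qed.

End TruncatedStatistic.

Lemma mutually_independent_pair (R : realType) (dT dU : measure_display)
    (T : measurableType dT) (U : measurableType dU) (P : probability T R)
    (I : finType) (K : {set I}) (Y : I -> {RV P >-> U}) i j (A B : set U) :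
  mutually_independent K Y -> i \in K -> j \in K -> i != j ->
  measurable A -> measurable B ->
  P (Y i @^-1` A `&` Y j @^-1` B) = (P (Y i @^-1` A) * P (Y j @^-1` B))%E.
Proof.
move=> ind iK jK ij mA mB.
have ji : (j == i) = false by rewrite eq_sym (negbTE ij).
(* Only the sets at i and j enter, so the family may take the value [B] everywhere else. *)
have := ind [set i; j]%SET (fun k => if k == i then A else B).
rewrite big_setU1 ?inE//= big_set1 eqxx ji => <-.
- congr (P _); apply/seteqP; split=> [w [Ai Bj] k /=|w h].
    by rewrite !inE => /orP[] /eqP ->; rewrite ?eqxx ?ji.
  split; first by have := h i; rewrite /= !inE !eqxx; apply.
  by have := h j; rewrite /= !inE !eqxx orbT ji; apply.
- by apply/fintype.subsetP => k; rewrite !inE => /orP[] /eqP ->.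
- by move=> k; case: ifP.
Qed.

(** * The Fisher information *)

Theorem theorem4p1 (R : realType) (d m q : nat)
    (hd : (1 <= d)%N) (hm : (2 <= m)%N) (hJ : (2 <= q + 1)%N)
    (x : 'I_m -> 'cV[R]_d) (hx : injective x)
    (n_ : 'I_m -> nat) (hn : (0 < \sum_(i < m) n_ i)%N)
    (p_ : 'I_q -> nat) (pc : nat)
    (h : forall j : 'I_q, 'cV[R]_d -> 'cV[R]_(p_ j))
    (hc : 'cV[R]_d -> 'cV[R]_pc)
    (t : logit_type)
    (pi : 'cV[R]_((\sum_(j < q) p_ j) + pc) -> 'I_m -> 'cV[R]_(q + 1))
    (hpi : forall theta, param_space t (fun i => X_mx h hc (x i)) theta ->
       logit_model t (fun i => X_mx h hc (x i)) theta (pi theta))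
    (theta : 'cV[R]_((\sum_(j < q) p_ j) + pc))
    (htheta : param_space t (fun i => X_mx h hc (x i)) theta)
    (dT : measure_display) (T : measurableType dT) (P : probability T R)
    (Y : 'I_m -> {RV P >-> (q + 1).-tuple nat})
    (hY : forall i, (0 < n_ i)%N -> is_multinomial (Y i) (n_ i) (pi theta i))
    (hind : mutually_independent [set i | (0 < n_ i)%N]%SET Y) :
  fisher_information n_ pi Y theta =
  map_mx EFin
    ((\sum_(i < m) n_ i)%N%:R *:
       ((G_mx h hc t x (pi theta))^T *m W_mx n_ (pi theta)
          *m G_mx h hc t x (pi theta))).
Proof.
pose A i : 'M[R]_(q, (\sum_(j < q) p_ j) + pc) :=
  row_mx (\mxrow_(j < q) (delta_mx j (ord0 : 'I_1) *m (h j (x i))^T))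
         ((const_mx 1 : 'cV[R]_q) *m (hc (x i))^T).
have model i := hpi _ htheta i.
have pi0 i j : 0 < pi theta i j ord0 by have [] := model i.
have pi1 i : \sum_j pi theta i j ord0 = 1 by have [] := model i.
pose a k i j : R := score_coef t A pi theta k i j.
have pia k i : \sum_j pi theta i j ord0 * a k i j = 0.
  exact: (sum_score_coef hpi htheta).
pose lin k i (y : (q + 1).-tuple nat) : R := \sum_j a k i j * (tnth y j)%:R.
pose S k w := score n_ pi (fun i => Y i w) theta k ord0.
(* Here the total of each Y_i is tested separately, whereas by [scoreE] the score vanishes as soon
   as one total is wrong. *)
pose Z k w : R :=
  \sum_(i < m | (0 < n_ i)%N) trunc_stat (Y i) (n_ i) (lin k i) w.
have aeN : \forall w \ae P, forall i, (0 < n_ i)%N ->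
    (\sum_j tnth (Y i w) j = n_ i)%N.
  apply: (@filter_forall _ _ (fun i w => (0 < n_ i)%N ->
    (\sum_j tnth (Y i w) j = n_ i)%N) _ (ae_filter_ringOfSetsType P)) => i.
  have [ni|_] := boolP (0 < n_ i)%N; last by apply: aeW.
  by apply: filterS (ae_sum_multinomial (pi1 i) (hY i ni)) => w.
pose full := \bigcap_(i in [set: 'I_m])
  (Y i @^-1` [set y | (0 < n_ i)%N -> (\sum_j tnth y j = n_ i)%N]).
have mfull : measurable full.
  apply: fin_bigcap_measurable => [|i _]; first exact: finite_finset.
  exact: measurable_preimage_RV.
(* An identity at every point, which yields the measurability of the score; almost sure equality
   with [Z] would not. *)
have SE k w : S k w = Z k w * \1_full w.
  rewrite /S (scoreE _ hpi htheta) indicE; case: ifPn => [/forall_inP Yn|nY].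
    rewrite mem_set => [|i _ ni]; last exact/eqP/Yn.
    rewrite mulr1; apply: eq_bigr => i ni; rewrite trunc_statE ifT//; exact: Yn.
  rewrite memNset ?mulr0// => fw; case/negP: nY; apply/forall_inP => i ni.
  by apply/eqP; exact: fw.
have aeSZ k : \forall w \ae P, S k w = Z k w.
  apply: filterS aeN => w Yn; rewrite SE indicE mem_set ?mulr1// => i _ ni.
  exact: Yn.
have EZ k : has_expectation P (Z k) 0.
  have <- : \sum_(i < m | (0 < n_ i)%N) (0 : R) = 0 by exact: big1.
  apply: has_expectation_sum => i ni.
  have := has_expectation_trunc_stat (lin k i) (hY i ni).
  by rewrite mexp_lin.
have mZ k := has_expectation_measurable (EZ k).
have mS k : measurable_fun setT (S k).
  rewrite (_ : S k = Z k \* \1_full); last by apply/funext => w; rewrite SE.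
  by apply: measurable_funM => //; exact: measurable_indic.
have ES k : ('E_P[S k] = 0%:E)%E.
  by rewrite (eq_expectation_ae (mS k) (mZ k)) ?(EZ k).2.
have EZZ k l : has_expectation P (fun w => Z k w * Z l w)
    (\sum_(i < m | (0 < n_ i)%N) (n_ i)%:R *
       \sum_j pi theta i j ord0 * (a k i j * a l i j)).
  under eq_fun do rewrite /Z mulr_suml.
  apply: has_expectation_sum => i ni; under eq_fun do rewrite mulr_sumr.
  rewrite -[X in has_expectation _ _ X]addr0.
  (* The expected value is spread over a sum with a single nonzero term, so that the double sum can
     be treated term by term. *)
  pose e i' : R := if i' == i then
    (n_ i)%:R * \sum_j pi theta i j ord0 * (a k i j * a l i j) else 0.
  rewrite (_ : _ + 0 = \sum_(i' < m | (0 < n_ i')%N) e i'); last first.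
    rewrite (bigD1 i) //= /e eqxx; congr (_ + _); apply/esym/big1 => i'.
    by case/andP => _ /negbTE ->.
  apply: has_expectation_sum => i' ni'; rewrite /e; case: eqVneq => [->|ii'].
    under eq_fun do rewrite trunc_statM.
    have := has_expectation_trunc_stat (fun y => lin k i y * lin l i y)
      (hY i ni).
    have := mexp_linM (pi1 i) (n_ i) 0 0 (pia k i) (pia l i).
    rewrite mul0r add0r => <-.
    by under [X in _ -> has_expectation _ _ X]eq_mexp do rewrite !add0r.
  (* For distinct settings the mean factors by independence, and the factors are centred. *)
  have := @has_expectation_trunc_statM _ _ _ P _ _ _ _ _ _ _
    (lin k i) (lin l i') (hY i ni) (hY i' ni').
  rewrite mexp_lin// mul0r; apply=> y y'.
  apply: (mutually_independent_pair hind); rewrite ?inE//.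
  - by rewrite eq_sym.
  - exact: measurable_tuple_nat.
  - exact: measurable_tuple_nat.
apply/matrixP => k l; rewrite [LHS]mxE [RHS]mxE gram_GWG//.
rewrite -[LHS]/(covariance P (S k) (S l)) covariance.unlock !ES.
(* Both means are 0, so the covariance is the mean of the product, and the scores may be exchanged
   for [Z] almost surely. *)
transitivity ('E_P[(fun w => (Z k w * Z l w)%R)])%E.
  apply: eq_expectation_ae.
  - by apply: measurable_funM; apply: measurable_funB.
  - exact: has_expectation_measurable (EZZ k l).
  - apply: filterS2 (aeSZ k) (aeSZ l) => w Sk Sl.
    by rewrite -Sk -Sl !fctE /= !subr0.
rewrite (EZZ k l).2; congr EFin.
(* Settings with n_i = 0 are absent from the likelihood and carry weight 0 in the Gram sum. *)
rewrite [RHS](bigID (fun i => (0 < n_ i)%N)) /=.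
rewrite [X in _ + X]big1 ?addr0 => [|i]; last first.
  by rewrite -eqn0Ngt => /eqP ->; rewrite mul0r.
apply: eq_bigr => i ni; congr (_ * _); apply: eq_bigr => j _.
rewrite !G_blockE /a /score_coef.
have p0 : pi theta i j ord0 != 0 by rewrite gt_eqF.
by field.
Qed.
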